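(* Let $(x,y,z)$ be Darboux coordinates on a three dimensional contact manifold $\mathcal{M}$ with contact form $\sigma=x\,dy+dz$ and volume form $d\mu=d\sigma\wedge\sigma$, and let $K$ be a smooth function with contact vector field $X_K$. Then the equations of motion $$\dot\alpha=VX_K^{c*}(\alpha)-(div_{d\mu}X_K)\,\alpha$$ for a time dependent one-form $\alpha=\alpha_xdx+\alpha_ydy+\alpha_zdz$ coincide with the Lie--Poisson equations $\dot\alpha=-\mathcal{L}_{X_K}\alpha-(div_{d\mu}X_K)\,\alpha$. Moreover, if $\alpha$ evolves by these equations, then the density function $$L=-\frac{\partial\alpha_x}{\partial y}+\frac{\partial\alpha_y}{\partial x}-x\frac{\partial\alpha_z}{\partial x}+x\frac{\partial\alpha_x}{\partial z}-2\alpha_z$$ evolves by the kinetic equation of contact particles $$\dot L=-\{L,K\}_c-2\,div_{d\mu}(X_K)\,L .$$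
   Context: For a smooth function $K=K(x,y,z)$ the contact vector field is $$X_K=\Big(\frac{\partial K}{\partial y}-x\frac{\partial K}{\partial z}\Big)\frac{\partial}{\partial x}-\frac{\partial K}{\partial x}\frac{\partial}{\partial y}+\Big(-K+x\frac{\partial K}{\partial x}\Big)\frac{\partial}{\partial z}.$$ $\mathcal{L}$ is the Lie derivative, and $div_{d\mu}X$ is defined by $\mathcal{L}_Xd\mu=(div_{d\mu}X)d\mu$. The contact Poisson (Lagrange) bracket is $$\{L,K\}_c=\frac{\partial L}{\partial x}\frac{\partial K}{\partial y}-\frac{\partial L}{\partial y}\frac{\partial K}{\partial x}+\frac{\partial K}{\partial z}\Big(L-x\frac{\partial L}{\partial x}\Big)-\frac{\partial L}{\partial z}\Big(K-x\frac{\partial K}{\partial x}\Big).$$ The complete cotangent lift of a vector field $X=X^a\partial/\partial x^a$ on $\mathcal{M}$ is the vector field on $T^*\mathcal{M}$ (coordinates $(x^a,\alpha_a)$) $$X^{c*}=X^a\frac{\partial}{\partial x^a}-\alpha_b\frac{\partial X^b}{\partial x^a}\frac{\partial}{\partial\alpha_a}.$$ Its vertical representative is the generalized vector field $$VX^{c*}=-\Big(\alpha_b\frac{\partial X^b}{\partial x^a}+X^b\frac{\partial\alpha_a}{\partial x^b}\Big)\frac{\partial}{\partial\alpha_a}.$$ For a one-form $\alpha$, $VX^{c*}(\alpha)$ denotes the one-form whose $dx^a$-component is the coefficient of $\partial/\partial\alpha_a$ in $VX^{c*}$ evaluated along $\alpha$. The dot denotes the time derivative. *)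

(* Defs.v *)
From HB Require Import structures.
From mathcomp Require Import all_boot all_order all_algebra all_fingroup.
From mathcomp Require Import all_classical all_reals all_analysis.

Set Implicit Arguments.
Unset Strict Implicit.
Unset Printing Implicit Defensive.

Import Order.TTheory GRing.Theory Num.Theory.
Import numFieldNormedType.Exports.

Local Open Scope classical_set_scope.
Local Open Scope ring_scope.

Section Calculus.
Context {R : realType}.

(* [U] is meant to be open.  Directional derivatives are taken in all
   directions so that the definition also applies to time-dependent functions,
   with [V := R * 'rV[R]_n]; for finite-dimensional [V] this is the usual
   class C^k. *)
Fixpoint Ck_on {V : normedModType R} (k : nat) (U : set V) (f : V -> R) : Prop :=
  (forall p, U p -> {for p, continuous f}) /\
  if k is k'.+1 then
    forall v, (forall p, U p -> derivable f p v) /\ Ck_on k' U ('D_v f)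
  else True.

Definition smooth_on {V : normedModType R} (U : set V) (f : V -> R) : Prop :=
  forall k, Ck_on k U f.

Context {n : nat}.
Local Notation E := 'rV[R]_n.

Definition partial (a : 'I_n) (f : E -> R) (p : E) : R :=
  'D_(delta_mx 0 a) f p.

Definition smooth_vfield_on (U : set E) (X : E -> E) : Prop :=
  forall a, smooth_on U (fun p => X p 0 a).

Definition vaction (X : E -> E) (f : E -> R) (p : E) : R :=
  \sum_a X p 0 a * partial a f p.

Definition vbracket (X Y : E -> E) (p : E) : E :=
  \row_a (vaction X (fun q => Y q 0 a) p - vaction Y (fun q => X q 0 a) p).

(* A differential [k]-form, as a function of the base point and of [k] tangent
   vectors.  Alternation and multilinearity are not part of the type; every
   form built below from [one_form] has them. *)
Definition form (k : nat) : Type := E -> ('I_k -> E) -> R.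

(* The one-form [\sum_a (alpha p)_a dx^a]. *)
Definition one_form (alpha : E -> E) : form 1 :=
  fun p v => \sum_a alpha p 0 a * v ord0 0 a.

Definition ext_deriv (k : nat) (w : form k) : form k.+1 :=
  fun p v => \sum_(i < k.+1) (-1) ^+ i *
    vaction (fun=> v i) (fun q => w q (fun j => v (lift i j))) p.

(* Normalised so that [dx^1 /\ ... /\ dx^n] takes the value 1 on the standard
   basis. *)
Definition wedge (k l : nat) (w : form k) (h : form l) : form (k + l) :=
  fun p v => ((k`! * l`!)%:R)^-1 * \sum_(s : 'S_(k + l)) (-1) ^+ s *
    (w p (fun i => v (s (lshift l i))) * h p (fun j => v (s (rshift k j)))).

(* The Lie derivative of a [k]-form, evaluated on vector fields:
   (L_X w)(Y_1, ..., Y_k)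
     = X(w(Y_1, ..., Y_k)) - \sum_i w(Y_1, ..., [X, Y_i], ..., Y_k). *)
Definition lie_derivative (k : nat) (X : E -> E) (w : form k)
    (Y : 'I_k -> E -> E) (p : E) : R :=
  vaction X (fun q => w q (fun i => Y i q)) p
  - \sum_i w p (fun j => if j == i then vbracket X (Y i) p else Y j p).

(* The value at [p] of the function determined by [L_X mu = (div_mu X) mu];
   the default 0 is only reached if there is no such value. *)
Definition divergence (k : nat) (U : set E) (mu : form k) (X : E -> E) (p : E)
    : R :=
  xget 0 [set c : R | forall Y : 'I_k -> E -> E,
    (forall i, smooth_vfield_on U (Y i)) ->
    lie_derivative X mu Y p = c * mu p (fun i => Y i p)].

(* Points of the cotangent bundle are pairs (base point, covector), both in
   coordinates; likewise for its tangent vectors. *)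
Definition cotangent_lift (X : E -> E) (q : E * E) : E * E :=
  (X q.1,
   - \row_a \sum_b q.2 0 b * partial a (fun p => X p 0 b) q.1).

(* The vertical representative of a vector field
   Z^a d/dx^a + Z_a d/dalpha_a on the cotangent bundle is
   (Z_a - Z^b dalpha_a/dx^b) d/dalpha_a; it is evaluated here along the
   one-form with components [alpha]. *)
Definition vertical_rep (Z : E * E -> E * E) (alpha : E -> E) (p : E) : E :=
  (Z (p, alpha p)).2 -
  \row_a \sum_b (Z (p, alpha p)).1 0 b * partial b (fun q => alpha q 0 a) p.

Lemma vertical_cotangent_liftE (X alpha : E -> E) (p : E) (a : 'I_n) :
  vertical_rep (cotangent_lift X) alpha p 0 a =
  - \sum_b (alpha p 0 b * partial a (fun q => X q 0 b) p
            + X p 0 b * partial b (fun q => alpha q 0 a) p).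
Proof. by rewrite /vertical_rep !mxE big_split opprD. Qed.

Definition time_deriv (alpha : R -> E -> E) (t : R) (p : E) : E :=
  \row_a derive1 (fun s => alpha s p 0 a) t.

End Calculus.

Section Contact.
Context {R : realType}.
Local Notation E := 'rV[R]_3.

(* The indices of the Darboux coordinates x, y, z. *)
Definition ix : 'I_3 := @Ordinal 3 0 isT.
Definition iy : 'I_3 := @Ordinal 3 1 isT.
Definition iz : 'I_3 := @Ordinal 3 2 isT.

Definition vec3 (a b c : R) : E := \row_(i < 3) nth 0 [:: a; b; c] i.

(* sigma = x dy + dz *)
Definition contact_form : form 1 := one_form (fun p : E => vec3 0 (p 0 ix) 1).

Definition contact_volume : form 3 :=
  wedge (ext_deriv contact_form) contact_form.

Definition contact_field (K : E -> R) (p : E) : E :=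
  let x := p 0 ix in
  vec3 (partial iy K p - x * partial iz K p)
       (- partial ix K p)
       (- K p + x * partial ix K p).

Definition contact_bracket (L K : E -> R) (p : E) : R :=
  let x := p 0 ix in
  partial ix L p * partial iy K p - partial iy L p * partial ix K p
  + partial iz K p * (L p - x * partial ix L p)
  - partial iz L p * (K p - x * partial ix K p).

Definition contact_density (alpha : E -> E) (p : E) : R :=
  let x := p 0 ix in
  let ax q := alpha q 0 ix in
  let ay q := alpha q 0 iy in
  let az q := alpha q 0 iz in
  - partial iy ax p + partial ix ay p - x * partial ix az p
  + x * partial iz ax p - 2 * az p.

End Contact.

(* Main.v *)
Require Import Defs.
From HB Require Import structures.
From mathcomp Require Import all_boot all_order all_algebra all_fingroup.
From mathcomp Require Import all_classical all_reals all_analysis.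
From mathcomp Require Import ring.

Set Implicit Arguments.
Unset Strict Implicit.
Unset Printing Implicit Defensive.

Import Order.TTheory GRing.Theory Num.Theory.
Import numFieldNormedType.Exports.

Local Open Scope classical_set_scope.
Local Open Scope ring_scope.

(** In Darboux coordinates [div X_K = - 2 K_z], and the product rule turns the
    Lie derivative of a one-form into minus the vertical representative of the
    cotangent lift; hence both systems read [alpha' = - L_X alpha + 2 K_z alpha].
    By the symmetry of second derivatives of functions of time and position,
    [L'] is obtained by differentiating this right-hand side in space.  All
    derivatives of [K] of order at least two then cancel, leaving
    [L' = - X_K(L) + 3 K_z L], which is the kinetic equation because
    [{L, K}_c = X_K(L) + K_z L]. *)

(** * Symmetry of mixed second derivatives in a normed space *)

Section SymmetryOfSecondDerivatives.
Context {R : realType} {V : normedModType R}.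
Implicit Types (f : V -> R) (p q v w : V).

(** The difference quotients of [f] along [v] and of its restriction to the line coincide, which
    makes the one-variable mean value theorem available. *)
Lemma is_derive_along_line f q v (s : R) :
  derivable f (s *: v + q) v ->
  is_derive s (1 : R) (fun r => f (r *: v + q)) ('D_v f (s *: v + q)).
Proof.
have quotE : (fun h : R => h^-1 *: (((fun r => f (r *: v + q)) \o shift s)
      (h *: (1 : R)) - f (s *: v + q))) =
    (fun h : R => h^-1 *: ((f \o shift (s *: v + q)) (h *: v)
      - f (s *: v + q))).
  by apply/funext => h /=; rewrite [h *: 1]mulr1 scalerDl addrA.
by move=> df; split; [rewrite /derivable quotE|rewrite /derive quotE].
Qed.

Lemma MVT_along_line f q v (h : R) : 0 < h ->
  (forall s : R, 0 <= s <= h -> derivable f (s *: v + q) v) ->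
  exists2 s : R, 0 <= s <= h &
    f (h *: v + q) - f q = 'D_v f (s *: v + q) * h.
Proof.
move=> h0 df.
have [s /itvP sh|s sh|s] := @MVT_segment R (fun r => f (r *: v + q))
  (fun r => 'D_v f (r *: v + q)) 0 h (ltW h0).
- by apply: is_derive_along_line; apply: df; rewrite !sh.
- apply: derivable_within_continuous => r /itvP rh.
  by apply/(@ex_derive _ _ _ _ _ _ _)/is_derive_along_line/df; rewrite !rh.
- move/itvP => sh E; exists s; first by rewrite !sh.
  by rewrite -{2}[q]add0r -(scale0r v) E subr0.
Qed.

(** The mean value theorem is applied twice: along [v] to the increment
    [g q = f (h *: w + q) - f q], whose derivative is an increment of ['D_v f], and then along [w]
    to ['D_v f] itself. *)
Lemma second_difference f p v w (h : R) : 0 < h ->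
  (forall s t : R, 0 <= s <= h -> 0 <= t <= h ->
     derivable f (s *: v + (t *: w + p)) v /\
     derivable ('D_v f) (s *: v + (t *: w + p)) w) ->
  exists s t : R, [/\ 0 <= s <= h, 0 <= t <= h &
    f (h *: v + (h *: w + p)) - f (h *: v + p) - f (h *: w + p) + f p
    = 'D_w ('D_v f) (s *: v + (t *: w + p)) * h ^+ 2].
Proof.
move=> h0 df.
have hh : 0 <= h <= h by rewrite (ltW h0) lexx.
have l0h : (0 : R) <= 0 <= h by rewrite lexx ltW.
pose g q := f (h *: w + q) - f q.
have gE s : 0 <= s <= h -> is_derive (s *: v + p) v g
    ('D_v f (s *: v + (h *: w + p)) - 'D_v f (s *: v + p)).
  move=> sh; have [d1 _] := df s h sh hh; have [d2 _] := df s 0 sh l0h.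
  rewrite scale0r add0r in d2.
  apply: is_deriveB; last exact: derivableP.
  have quotE : (fun r : R => r^-1 *: (((fun q => f (h *: w + q))
        \o shift (s *: v + p)) (r *: v) - f (h *: w + (s *: v + p)))) =
      (fun r : R => r^-1 *: ((f \o shift (s *: v + (h *: w + p))) (r *: v)
        - f (s *: v + (h *: w + p)))).
    by apply/funext => r /=; rewrite ![in LHS](addrCA (h *: w)).
  split; first by rewrite /derivable quotE; exact: d1.
  by rewrite /derive quotE.
have [s sh|s sh gs] := @MVT_along_line g p v h h0.
  by have [] := gE s sh.
have [|t th Dt] := @MVT_along_line ('D_v f) (s *: v + p) w h h0.
  by move=> t th; have [_] := df s t sh th; rewrite addrCA.
exists s, t; split => //.
move: gs; have [_ ->] := gE s sh; rewrite addrCA Dt /g.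
rewrite [s *: v + (t *: w + p)]addrCA [h *: v + (h *: w + p)]addrCA.
by rewrite expr2 mulrA => <-; rewrite opprD opprK [RHS]addrA.
Qed.

Lemma near_parallelogram p v w (P : set V) : nbhs p P ->
  exists2 h : R, 0 < h & forall s t : R, 0 <= s <= h -> 0 <= t <= h ->
    P (s *: v + (t *: w + p)).
Proof.
(* The summand 1 keeps [c] positive and the final estimate strict, even when [v] and [w] both
   vanish. *)
move=> /nbhs_ballP[d /= d0 dP]; pose c := 1 + `|v| + `|w|.
have vw0 : 0 <= `|v| + `|w| by rewrite addr_ge0.
have c0 : 0 < c by rewrite /c -addrA ltr_pwDl.
exists (d / c) => [|s t /andP[s0 sh] /andP[t0 th]]; first by rewrite divr_gt0.
apply: dP; rewrite -ball_normE /ball_ /= distrC addrA addrK.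
rewrite (le_lt_trans (ler_normD _ _))// !normrZ !ger0_norm//.
apply: (@le_lt_trans _ _ (d / c * (`|v| + `|w|))).
  by rewrite mulrDr lerD// ler_wpM2r.
rewrite -[ltRHS](divfK (lt0r_neq0 c0) d) ltr_pM2l ?divr_gt0//.
by rewrite /c -addrA ltrDr ltr01.
Qed.

(* At suitable points of a small parallelogram, both mixed derivatives equal
   the second difference divided by h ^ 2. *)
Lemma derive_swap f (U : set V) p v w : open U -> U p ->
  (forall q, U q -> [/\ derivable f q v, derivable f q w,
     derivable ('D_v f) q w & derivable ('D_w f) q v]) ->
  {for p, continuous ('D_w ('D_v f))} ->
  {for p, continuous ('D_v ('D_w f))} ->
  'D_w ('D_v f) p = 'D_v ('D_w f) p.
Proof.
move=> oU Up df cwv cvw.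
apply/eqP; rewrite -subr_eq0 -normr_le0; apply/ler_addgt0Pl => e e0.
rewrite addr0.
have e20 : 0 < e / 2 by rewrite divr_gt0.
(* Here [c] will be the common value that the two mixed derivatives take at two possibly different
   points near [p]. *)
have triangle (a b c : R) : `|a - c| < e / 2 -> `|b - c| < e / 2 ->
    `|a - b| <= e.
  move=> ac bc; rewrite (_ : a - b = (a - c) - (b - c)); last by ring.
  rewrite (le_trans (ler_normB _ _))//.
  by rewrite [leRHS](splitr e) lerD// ltW.
pose P : set V := fun q => [/\ U q,
    `|'D_w ('D_v f) p - 'D_w ('D_v f) q| < e / 2 &
    `|'D_v ('D_w f) p - 'D_v ('D_w f) q| < e / 2].
have near_p : nbhs p P.
  have nU : \forall q \near p, U q by apply: open_nbhs_nbhs.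
  have near_lt (g : V -> R) : {for p, continuous g} ->
      \forall q \near p, `|g p - g q| < e / 2.
    by move=> /pseudometric_normed_Zmodule.cvgrPdist_lt; exact.
  have nwv := near_lt _ cwv; have nvw := near_lt _ cvw.
  apply: filterS3 nU nwv nvw => q Uq qwv qvw.
  by split; [exact: Uq|exact: qwv|exact: qvw].
have [h h0 hP] := near_parallelogram v w near_p.
have [s [t [sh th E1]]] : exists s t : R, [/\ 0 <= s <= h, 0 <= t <= h & _] :=
  @second_difference f p v w _ h0 (fun s t sh th =>
    let: And3 Uq _ _ := hP s t sh th in
    let: And4 d1 _ d2 _ := df _ Uq in conj d1 d2).
have [|t' [s' [th' sh' E2]]] := @second_difference f p w v _ h0.
  move=> t1 s1 th1 sh1; have [Uq _ _] := hP s1 t1 sh1 th1.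
  by rewrite addrCA; have [_ dw _ dwv] := df _ Uq; split; [exact: dw|exact: dwv].
have Es : 'D_w ('D_v f) (s *: v + (t *: w + p)) =
    'D_v ('D_w f) (s' *: v + (t' *: w + p)).
  apply: (@mulIf _ (h ^+ 2)); first by rewrite expf_neq0// gt_eqF.
  rewrite [s' *: v + _]addrCA; apply: (etrans (esym E1)); apply: (etrans _ E2).
  by rewrite [h *: w + (h *: v + _)]addrCA; congr (_ + _); exact: addrAC.
have [_ l1 _] := hP s t sh th; have [_ _ l2] := hP s' t' sh' th'.
rewrite -Es in l2.
exact: triangle l1 l2.
Qed.

End SymmetryOfSecondDerivatives.

(** * Pointwise derivation rules *)

Section DerivationRules.
Context {R : realType} {V : normedModType R}.

(** This rule and the next three are restated with functions written pointwise, so that a proof term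
    built from them has the shape of the formula being differentiated. *)
Lemma is_derive_add (f g : V -> R) p v df dg :
  is_derive p v f df -> is_derive p v g dg ->
  is_derive p v (fun q => f q + g q) (df + dg).
Proof. exact: is_deriveD. Qed.

Lemma is_derive_mul (f g : V -> R) p v df dg :
  is_derive p v f df -> is_derive p v g dg ->
  is_derive p v (fun q => f q * g q) (f p * dg + g p * df).
Proof. exact: is_deriveM. Qed.

Lemma is_derive_opp (f : V -> R) p v df :
  is_derive p v f df -> is_derive p v (fun q => - f q) (- df).
Proof. exact: is_deriveN. Qed.

Lemma is_derive_const (k : R) (p v : V) :
  is_derive p v (fun=> k) 0.
Proof. exact: is_derive_cst. Qed.

End DerivationRules.

(** * Lie derivative of a one-form and the cotangent lift *)

Section ExteriorCalculus.
Context {R : realType} {n : nat}.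
Local Notation E := 'rV[R]_n.

Lemma is_derive_coord (p v : E) (a : 'I_n) :
  is_derive p v (fun q : E => q 0 a) (v 0 a).
Proof.
have d : derivable (id : E -> E) p v by exact: derivable_id.
split; first by move/derivable_mxP: d; apply.
by have := derive_mx d; rewrite derive_id => /(congr1 (fun M : E => M 0 a)) ->;
  rewrite mxE.
Qed.

(** By the product rule, the derivative of [alpha] paired with [Y] contains [alpha] paired with the
    derivative of [Y] along [X]. The bracket term removes it, so no derivative of [Y] survives. *)
Lemma lie_derivative_one_form (X alpha : E -> E) (Y : 'I_1 -> E -> E) (p : E) :
  (forall a b, derivable (fun q => alpha q 0 a) p (delta_mx 0 b)) ->
  (forall a b, derivable (fun q => Y ord0 q 0 a) p (delta_mx 0 b)) ->
  lie_derivative X (one_form alpha) Y p =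
  - one_form (vertical_rep (cotangent_lift X) alpha) p (fun i => Y i p).
Proof.
move=> dalpha dY; rewrite /lie_derivative big_ord1 /one_form /=.
have partialE b : partial b (fun q => \sum_a alpha q 0 a * Y ord0 q 0 a) p =
    \sum_a (alpha p 0 a * partial b (fun q => Y ord0 q 0 a) p
            + Y ord0 p 0 a * partial b (fun q => alpha q 0 a) p).
  rewrite /partial; apply: derive_val.
  rewrite (_ : (fun q => _) =
    \sum_a ((fun q => alpha q 0 a) * (fun q => Y ord0 q 0 a))); last first.
    by apply/funext => q; rewrite fct_sumE.
  by apply: is_derive_sum => a; apply: is_deriveM; exact: derivableP.
rewrite /vaction (eq_bigr _ (fun b _ => congr1 ( *%R _) (partialE b))).
under eq_bigr do rewrite mulr_sumr.
rewrite exchange_big /=.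
under [in RHS]eq_bigr do rewrite vertical_cotangent_liftE big_split mulNr mulrDl.
rewrite sumrN opprK big_split /=.
(* Exchanging the sums makes [alpha] carry the outer index, as it does in the bracket term, so that
   the two sides agree summand by summand. *)
under [X in _ = X + _]eq_bigr do rewrite mulr_suml.
rewrite [X in _ = X + _]exchange_big -big_split -sumrB /=.
apply: eq_bigr => a _; rewrite mxE /vaction mulrBr !mulr_sumr mulr_suml.
rewrite -!sumrB -big_split /=; apply: eq_bigr => b _; ring.
Qed.

End ExteriorCalculus.

(** * The contact volume form as a determinant *)

Section ContactVolume.
Context {R : realType}.
Local Notation E := 'rV[R]_3.

(** Stated for a general monoid law because it serves both sums over coordinates and the products in
    the Leibniz formula. *)
Lemma big_ord3 (T : Type) (idx : T) (op : Monoid.law idx) (F : 'I_3 -> T) :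
  \big[op/idx]_a F a = op (F ix) (op (F iy) (F iz)).
Proof.
rewrite !big_ord_recl big_ord0 Monoid.mulm1.
by congr (op (F _) (op (F _) (F _))); exact: val_inj.
Qed.

Lemma sum_ord3 (S : nmodType) (F : 'I_3 -> S) :
  \sum_a F a = F ix + (F iy + F iz).
Proof. exact: big_ord3. Qed.

Lemma det_mx33 (S : comPzRingType) (A : 'M[S]_3) :
  \det A = A ix ix * (A iy iy * A iz iz - A iy iz * A iz iy)
         - A ix iy * (A iy ix * A iz iz - A iy iz * A iz ix)
         + A ix iz * (A iy ix * A iz iy - A iy iy * A iz ix).
Proof.
(* With entries indexed by natural numbers, the lifted indices of the cofactor expansions compute to
   numerals. *)
pose a (i j : nat) := A (inord i) (inord j).
have AE i j : A i j = a i j by rewrite /a !inord_val.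
rewrite (expand_det_row _ ord0) !big_ord_recl big_ord0 /cofactor.
rewrite !(expand_det_row _ ord0) !big_ord_recl !big_ord0 /cofactor !det_mx11.
rewrite !mxE !AE /= /bump /=; ring.
Qed.

(* The sum over 'S_3 defining the wedge product is a sum of two equal
   determinants, with columns x, y and x y + z. *)
Lemma contact_volumeE (p : E) (v : 'I_3 -> E) :
  contact_volume p v = \det (\matrix_(i, j) v i 0 j).
Proof.
pose c (i : 'I_3) := p 0 ix * v i 0 iy + v i 0 iz.
have sigmaE (q : E) (u : E) : \sum_a vec3 0 (q 0 ix) 1 0 a * u 0 a =
    q 0 ix * u 0 iy + u 0 iz.
  by rewrite sum_ord3 !mxE /= mul0r add0r mul1r.
have dsigmaE (u : 'I_2 -> E) : ext_deriv contact_form p u =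
    u ord0 0 ix * u ord_max 0 iy - u ord_max 0 ix * u ord0 0 iy.
  have partialE (a : 'I_3) (w : 'I_1 -> E) :
      partial a (contact_form ^~ w) p = (ix == a)%:R * w ord0 0 iy.
    rewrite (_ : contact_form ^~ w = (fun q => q 0 ix * w ord0 0 iy + w ord0 0 iz));
      last by apply/funext => q; exact: sigmaE.
    apply: derive_val; apply: (is_derive_eq (is_derive_add
      (is_derive_mul (is_derive_coord p _ ix) (is_derive_const (w ord0 0 iy) p _))
      (is_derive_const (w ord0 0 iz) p _))).
    by rewrite mxE /= mulr0 add0r addr0 mulrC.
  rewrite /ext_deriv !big_ord_recl big_ord0 /vaction !sum_ord3 !partialE /=.
  rewrite (_ : lift ord0 ord0 = ord_max :> 'I_2); last exact: val_inj.
  rewrite (_ : lift ord_max ord0 = ord0 :> 'I_2); last exact: val_inj.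
  by rewrite /bump /=; ring.
pose F (s : 'S_3) := (-1) ^+ s * (v (s ix) 0 ix * v (s iy) 0 iy * c (s iz)).
have -> : contact_volume p v = \sum_s F s.
  rewrite /contact_volume /wedge.
  under eq_bigr => s _.
    rewrite dsigmaE /contact_form /one_form sigmaE -/(c _).
    rewrite (_ : lshift 1 ord0 = ix :> 'I_(2 + 1)); last exact: val_inj.
    rewrite (_ : lshift 1 ord_max = iy :> 'I_(2 + 1)); last exact: val_inj.
    rewrite (_ : rshift 2 ord0 = iz :> 'I_(2 + 1)); last exact: val_inj.
    rewrite mulrBl mulrBr -/(F s).
    over.
  (* Composing with the transposition of x and y turns the second half of the two-form dx dy into
     minus the first. The resulting factor 2 cancels the normalisation of [wedge]. *)
  rewrite sumrB [X in _ - X](reindex_inj (mulgI (tperm ix iy))) /=.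
  rewrite [X in _ - X](_ : _ = - \sum_s F s); last first.
    rewrite -sumrN; apply: eq_bigr => s _.
    rewrite odd_permM odd_tperm /= !permM tpermL tpermR tpermD//.
    by rewrite signrN /F mulNr.
  by rewrite opprK -mulr2n -[_ *+ 2]mulr_natl mulKf// pnatr_eq0.
(* This matrix is transposed, so that [s] permutes the vectors in the Leibniz formula. Its last row
   differs from the z coordinates by a multiple of the y row, which leaves the determinant
   unchanged. *)
transitivity (\det (\matrix_(i, j) [:: v j 0 ix; v j 0 iy; c j]`_i)).
  by apply: eq_bigr => s _; rewrite big_ord3 !mxE /= /F !mulrA.
rewrite !det_mx33 !mxE /= /c; ring.
Qed.

End ContactVolume.

(** * Closure properties of smooth functions *)

Section SmoothFunctions.
Context {R : realType}.

Lemma smooth_on_cst {V : normedModType R} (U : set V) (c : R) :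
  smooth_on U (fun=> c).
Proof.
move=> k; elim: k c => [|k IHk] c; split=> //=.
- by move=> p _; exact: cst_continuous.
- by move=> p _; exact: cst_continuous.
- move=> v; split=> [p _|]; first exact: derivable_cst.
  by rewrite (_ : 'D_v (fun=> c) = fun=> 0)//; apply/funext => p; exact: derive_cst.
Qed.

Context {V : normedModType R}.
Variable U : set V.
Implicit Types f : V -> R.

Lemma smooth_on_continuous f p : smooth_on U f -> U p -> {for p, continuous f}.
Proof. by move=> /(_ 0%N)[+ _]; exact. Qed.

Lemma smooth_on_derivable f p v : smooth_on U f -> U p -> derivable f p v.
Proof. by move=> /(_ 1%N)[_ /(_ v)[+ _]]; exact. Qed.

Lemma smooth_on_derive f v : smooth_on U f -> smooth_on U ('D_v f).
Proof. by move=> sf k; have [_ /(_ v)[_]] := sf k.+1. Qed.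

Lemma smooth_on_derive_swap f p v w : open U -> smooth_on U f -> U p ->
  'D_w ('D_v f) p = 'D_v ('D_w f) p.
Proof.
move=> oU sf Up; have sD := smooth_on_derive.
apply: (derive_swap oU Up) => [q Uq||].
- by split; apply: smooth_on_derivable Uq => //; exact: sD.
- exact: (smooth_on_continuous (sD _ _ (sD _ _ sf)) Up).
- exact: (smooth_on_continuous (sD _ _ (sD _ _ sf)) Up).
Qed.

End SmoothFunctions.

(** * Functions of time and position: slices and exchange of derivatives *)

Section ProductSlices.
Context {R : realType} {V : normedModType R}.
Implicit Types (g : R * V -> R) (t : R) (p w : V).

(** An equality of difference quotients transfers both derivability and the value of the
    derivative. *)
Lemma derive_quotient_space g t p w :
  (fun h : R => h^-1 *: ((g \o shift (t, p)) (h *: ((0, w) : R * V)) - g (t, p)))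
  = (fun h : R => h^-1 *: (((fun q => g (t, q)) \o shift p) (h *: w) - g (t, p))).
Proof.
apply/funext => h /=; congr (_ *: (g _ - _)).
by rewrite /shift /=; congr pair; rewrite /= scaler0 add0r.
Qed.

Lemma derive_quotient_time g t p :
  (fun h : R => h^-1 *: ((g \o shift (t, p)) (h *: ((1, 0) : R * V)) - g (t, p)))
  = (fun h : R => h^-1 *: (((fun s => g (s, p)) \o shift t) (h *: (1 : R))
      - g (t, p))).
Proof.
apply/funext => h /=; congr (_ *: (g _ - _)).
by rewrite /shift /=; congr pair; rewrite /= scaler0 add0r.
Qed.

Lemma derive_space g t p w :
  'D_((0, w) : R * V) g (t, p) = 'D_w (fun q => g (t, q)) p.
Proof. by rewrite /derive derive_quotient_space. Qed.

Lemma is_derive_time g t p : derivable g (t, p) ((1, 0) : R * V) ->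
  is_derive t (1 : R) (fun s => g (s, p)) ('D_((1, 0) : R * V) g (t, p)).
Proof.
by move=> dg; split; [rewrite /derivable|rewrite /derive];
  rewrite -derive_quotient_time.
Qed.

(** The derivative of a slice along [v] is the slice of the derivative along [(0, v)], which is
    again smooth on the product; hence the induction on the order. *)
Lemma smooth_on_slice (J : set R) (U : set V) g t :
  smooth_on (J `*` U) g -> J t -> smooth_on U (fun q => g (t, q)).
Proof.
move=> sg Jt k.
have cg (f : R * V -> R) p : smooth_on (J `*` U) f -> U p ->
    {for p, continuous (fun q => f (t, q))}.
  move=> sf Up; have JUp : (J `*` U) (t, p) by [].
  apply: (@continuous_comp _ _ _ (pair t) f p).
    exact: (cvg_pair (@cvg_cst _ t V (nbhs p) _) (@cvg_id V (nbhs p))).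
  exact: smooth_on_continuous sf JUp.
elim: k g sg => [|k IHk] g sg; split=> //; try by move=> p; exact: cg.
move=> v; split=> [p Up|].
  rewrite /derivable -derive_quotient_space.
  have JUp : (J `*` U) (t, p) by []; exact: smooth_on_derivable _ sg JUp.
rewrite (_ : 'D_v _ = (fun q => 'D_((0, v) : R * V) g (t, q))).
  by apply: (IHk ('D_((0, v) : R * V) g)); exact: smooth_on_derive.
by apply/funext => q; rewrite derive_space.
Qed.

(** This is the symmetry of second derivatives on [R * V] for the directions [(1, 0)] and
    [(0, w)]. *)
Lemma is_derive_time_space (J : set R) (U : set V) g t p w :
  open J -> open U -> smooth_on (J `*` U) g -> J t -> U p ->
  is_derive t (1 : R) (fun s => 'D_w (fun q => g (s, q)) p)
    ('D_w (fun q => derive1 (fun s => g (s, q)) t) p).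
Proof.
move=> oJ oU sg Jt Up; have JUp : (J `*` U) (t, p) by split.
have oJU : open (J `*` U).
  rewrite openE => -[s q] [/= Js Uq].
  by exists (J, U); [split; exact: open_nbhs_nbhs|case].
rewrite (_ : (fun s => _) = (fun s => 'D_((0, w) : R * V) g (s, p))); last first.
  by apply/funext => s; rewrite derive_space.
apply: is_derive_eq.
  apply: (@is_derive_time ('D_((0, w) : R * V) g)).
  by apply: smooth_on_derivable JUp; exact: smooth_on_derive.
rewrite (smooth_on_derive_swap _ _ oJU sg JUp) derive_space.
(* The two expressions for the time derivative are compared at points of [U], which is enough for
   the outer derivative at [p]. *)
apply: near_eq_derive; have nU : \forall q \near p, U q by exact: open_nbhs_nbhs.
apply: filterS nU => q Uq; have JUq : (J `*` U) (t, q) by [].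
rewrite derive1E; apply/esym/derive_val/is_derive_time.
exact: smooth_on_derivable _ sg JUq.
Qed.

End ProductSlices.

(** * Divergence of contact fields and evolution of the density *)

Section ContactDivergence.
Context {R : realType}.
Local Notation E := 'rV[R]_3.
Local Notation A := is_derive_add.
Local Notation M := is_derive_mul.
Local Notation N := is_derive_opp.
Local Notation C := is_derive_const.

Lemma vaction_ord3 (X : E -> E) (f : E -> R) (p : E) : vaction X f p =
  X p 0 ix * partial ix f p + (X p 0 iy * partial iy f p + X p 0 iz * partial iz f p).
Proof. exact: sum_ord3. Qed.

(** The derivatives of the [Y i] cancel against the brackets. What remains is the sum of the
    determinants in which one vector is replaced by its image under the Jacobian of [X], that is,
    the trace times the determinant. *)
Lemma lie_derivative_contact_volume (X : E -> E) (Y : 'I_3 -> E -> E) (p : E) :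
  (forall i a b, derivable (fun q => Y i q 0 a) p (delta_mx 0 b)) ->
  lie_derivative X contact_volume Y p =
  (\sum_a partial a (fun q => X q 0 a) p) * contact_volume p (fun i => Y i p).
Proof.
move=> dY.
have D b i a : is_derive p (delta_mx 0 b) (fun q => Y i q 0 a)
    (partial b (fun q => Y i q 0 a) p) by exact: derivableP.
(* Only sums, products and opposites occur, so that the term [dmu] can follow the formula node by
   node. *)
have muE q (v : 'I_3 -> E) : contact_volume q v =
    v ix 0 ix * (v iy 0 iy * v iz 0 iz + - (v iy 0 iz * v iz 0 iy))
    + - (v ix 0 iy * (v iy 0 ix * v iz 0 iz + - (v iy 0 iz * v iz 0 ix)))
    + v ix 0 iz * (v iy 0 ix * v iz 0 iy + - (v iy 0 iy * v iz 0 ix)).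
  by rewrite contact_volumeE det_mx33 !mxE.
rewrite /lie_derivative.
rewrite (funext (fun q => muE q (fun i => Y i q))).
have dmu b := derive_val (is_derive := A (A
  (M (D b ix ix) (A (M (D b iy iy) (D b iz iz)) (N (M (D b iy iz) (D b iz iy)))))
  (N (M (D b ix iy)
    (A (M (D b iy ix) (D b iz iz)) (N (M (D b iy iz) (D b iz ix)))))))
  (M (D b ix iz) (A (M (D b iy ix) (D b iz iy)) (N (M (D b iy iy) (D b iz ix)))))).
rewrite !sum_ord3 vaction_ord3 ![partial _ (fun q => _ + _ + _) _]dmu.
rewrite !muE /= !mxE !vaction_ord3.
do ?match goal with |- context [partial ?b ?f p] =>
  move: (partial b f p) => ? end.
do ?match goal with |- context [fun_of_matrix ?B 0 ?a] =>
  move: (B 0 a) => ? end.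
ring.
Qed.

Lemma vec3E (a b c : R) (i : 'I_3) : vec3 a b c 0 i = [:: a; b; c]`_i.
Proof. by rewrite mxE. Qed.

Lemma smooth_vfield_delta n (U : set 'rV[R]_n) (i : 'I_n) :
  smooth_vfield_on U (fun=> delta_mx 0 i).
Proof. by move=> a; exact: smooth_on_cst. Qed.

(** The trace of the Jacobian is a valid value, so the default of [xget] is not reached. It is the
    only one, since the volume form takes the value 1 on the constant coordinate fields. *)
Lemma divergence_contact_volume (U : set E) (X : E -> E) (p : E) : U p ->
  divergence U contact_volume X p = \sum_a partial a (fun q => X q 0 a) p.
Proof.
move=> Up; apply: xget_unique => [Y sY|c].
  apply: lie_derivative_contact_volume => i a b.
  exact: smooth_on_derivable _ (sY i a) Up.
move=> /(_ (fun i => fun=> delta_mx 0 i) (fun i => smooth_vfield_delta U i)).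
rewrite lie_derivative_contact_volume => [|i a b]; last exact: derivable_cst.
rewrite contact_volumeE (_ : \matrix_(i, j) _ = 1%:M) ?det1 ?mulr1//.
by apply/matrixP => i j; rewrite !mxE eqxx eq_sym.
Qed.

Context (U : set E) (K : E -> R) (oU : open U) (sK : smooth_on U K).

Let X := contact_field K.

Lemma contact_field_ix :
  (fun q => X q 0 ix) = (fun q => partial iy K q + - (q 0 ix * partial iz K q)).
Proof. by apply/funext => q; rewrite vec3E. Qed.

Lemma contact_field_iy : (fun q => X q 0 iy) = (fun q => - partial ix K q).
Proof. by apply/funext => q; rewrite vec3E. Qed.

Lemma contact_field_iz :
  (fun q => X q 0 iz) = (fun q => - K q + q 0 ix * partial ix K q).
Proof. by apply/funext => q; rewrite vec3E. Qed.

Lemma smooth_is_partial (f : E -> R) (p : E) (a : 'I_3) :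
  smooth_on U f -> U p -> is_derive p (delta_mx 0 a) f (partial a f p).
Proof. by move=> sf Up; apply: derivableP; exact: smooth_on_derivable _ sf Up. Qed.

Lemma smooth_on_partial (f : E -> R) (a : 'I_3) :
  smooth_on U f -> smooth_on U (partial a f).
Proof. by move=> sf; exact: smooth_on_derive. Qed.

Lemma partial_swap (f : E -> R) (p : E) (a b : 'I_3) :
  smooth_on U f -> U p -> partial a (partial b f) p = partial b (partial a f) p.
Proof.
exact: (@smooth_on_derive_swap _ _ _ f p (delta_mx 0 b) (delta_mx 0 a) oU).
Qed.

(** The inner exchange holds throughout a neighbourhood of [p], so it may be differentiated once
    more. *)
Lemma partial_swap_inner (f : E -> R) (p : E) (a b c : 'I_3) :
  smooth_on U f -> U p ->
  partial a (partial b (partial c f)) p = partial a (partial c (partial b f)) p.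
Proof.
move=> sf Up; have nU : \forall q \near p, U q by exact: open_nbhs_nbhs.
exact: near_eq_derive (@filterS _ _ (nbhs_filter p) _ _
  (fun q Uq => partial_swap b c sf Uq) nU).
Qed.

(** The factor [(delta_mx 0 c : E) 0 ix] is the derivative of the coordinate x, left unevaluated so
    that one formula covers all directions [c]. *)
Lemma partial_contact_field_ix (p : E) (c : 'I_3) : U p ->
  partial c (fun q => X q 0 ix) p = partial c (partial iy K) p
  + - (p 0 ix * partial c (partial iz K) p
       + partial iz K p * (delta_mx 0 c : E) 0 ix).
Proof.
move=> Up; have D a := smooth_is_partial c (smooth_on_partial a sK) Up.
rewrite contact_field_ix; apply: derive_val.
exact: (A (D iy) (N (M (is_derive_coord p (delta_mx 0 c) ix) (D iz)))).
Qed.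

Lemma partial_contact_field_iy (p : E) (c : 'I_3) : U p ->
  partial c (fun q => X q 0 iy) p = - partial c (partial ix K) p.
Proof.
move=> Up; have D a := smooth_is_partial c (smooth_on_partial a sK) Up.
by rewrite contact_field_iy; apply: derive_val; exact: (N (D ix)).
Qed.

Lemma partial_contact_field_iz (p : E) (c : 'I_3) : U p ->
  partial c (fun q => X q 0 iz) p = - partial c K p
  + (p 0 ix * partial c (partial ix K) p
     + partial ix K p * (delta_mx 0 c : E) 0 ix).
Proof.
move=> Up; have D a := smooth_is_partial c (smooth_on_partial a sK) Up.
rewrite contact_field_iz; apply: derive_val.
exact: (A (N (smooth_is_partial c sK Up))
  (M (is_derive_coord p (delta_mx 0 c) ix) (D ix))).
Qed.

(** The second derivatives of [K] cancel by symmetry. The x and z components of the field each leave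
    one [- partial iz K p]. *)
Lemma divergence_contact_field (p : E) : U p ->
  divergence U contact_volume X p = - (2 * partial iz K p).
Proof.
move=> Up; rewrite divergence_contact_volume// sum_ord3.
rewrite partial_contact_field_ix// partial_contact_field_iy//.
rewrite partial_contact_field_iz// !mxE /=.
rewrite (partial_swap iy ix sK Up) (partial_swap iz ix sK Up).
do ?match goal with |- context [partial ?b ?f p] =>
  move: (partial b f p) => ? end.
ring.
Qed.

(** The right-hand side is spelled out in sums, products and opposites so that it can be
    differentiated in space by an explicit term. *)
Lemma lift_rhsE (a : E -> E) (p : E) (c : 'I_3) : U p ->
  (vertical_rep (cotangent_lift X) a p
   - divergence U contact_volume X p *: a p) 0 c =
  - (a p 0 ix * (partial c (partial iy K) p
       + - (p 0 ix * partial c (partial iz K) p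
            + partial iz K p * (delta_mx 0 c : E) 0 ix))
     + (partial iy K p + - (p 0 ix * partial iz K p))
       * partial ix (fun q => a q 0 c) p
     + (a p 0 iy * (- partial c (partial ix K) p)
        + (- partial ix K p) * partial iy (fun q => a q 0 c) p)
     + (a p 0 iz * (- partial c K p + (p 0 ix * partial c (partial ix K) p
          + partial ix K p * (delta_mx 0 c : E) 0 ix))
        + (- K p + p 0 ix * partial ix K p) * partial iz (fun q => a q 0 c) p))
  + 2 * partial iz K p * a p 0 c.
Proof.
move=> Up; have subE (u v : E) (k : R) : (u - k *: v) 0 c = u 0 c - k * v 0 c.
  by rewrite !mxE.
rewrite subE divergence_contact_field// vertical_cotangent_liftE sum_ord3.
rewrite partial_contact_field_ix//.
rewrite partial_contact_field_iy// partial_contact_field_iz// /X !vec3E /=.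
by rewrite [- (2 * _) * _]mulNr opprK !addrA.
Qed.

Lemma contact_density_evolution (J : set R) (alpha : R -> E -> E) :
  open J ->
  (forall a, smooth_on (J `*` U) (fun q : R * E => alpha q.1 q.2 0 a)) ->
  (forall t p, J t -> U p -> time_deriv alpha t p =
    vertical_rep (cotangent_lift X) (alpha t) p
    - divergence U contact_volume X p *: alpha t p) ->
  forall t p, J t -> U p ->
    is_derive t (1 : R) (fun s => contact_density (alpha s) p)
      (- contact_bracket (contact_density (alpha t)) K p
       - 2 * divergence U contact_volume X p * contact_density (alpha t) p).
Proof.
move=> oJ salpha eqs t p Jt Up.
have sa c : smooth_on U (fun q : E => alpha t q 0 c).
  exact: (smooth_on_slice (salpha c) Jt).
pose dalpha c q := derive1 (fun s => alpha s q 0 c) t.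
have T a c : is_derive t (1 : R) (fun s => partial a (fun q => alpha s q 0 c) p)
    (partial a (dalpha c) p).
  exact: (is_derive_time_space _ oJ oU (salpha c) Jt Up).
have T0 c : is_derive t (1 : R) (fun s => alpha s p 0 c) (dalpha c p).
  have JUp : (J `*` U) (t, p) by [].
  rewrite /dalpha derive1E; apply: derivableP.
  have d : derivable (fun q : R * E => alpha q.1 q.2 0 c) (t, p)
      ((1, 0) : R * E) by exact: smooth_on_derivable (salpha c) JUp.
  by have [] := is_derive_time d.
(* The equations of motion are given on [U]; as [U] is a neighbourhood of [p], they can be
   differentiated in space at [p]. *)
have dalphaE c q (Uq : U q) := etrans (esym (etrans
  (congr1 (fun v : E => v 0 c) (eqs t q Jt Uq)) (lift_rhsE (alpha t) c Uq)))
  (mxE _ _ _ _).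
have nU : \forall q \near p, U q by exact: open_nbhs_nbhs.
have nE c := @filterS _ _ (nbhs_filter p) _ _ (dalphaE c) nU.
have K0 a := smooth_is_partial a sK Up.
have K1 a b := smooth_is_partial a (smooth_on_partial b sK) Up.
have K2 a b c :=
  smooth_is_partial a (smooth_on_partial b (smooth_on_partial c sK)) Up.
have a0 a c := smooth_is_partial a (sa c) Up.
have a1 a b c := smooth_is_partial a (smooth_on_partial b (sa c)) Up.
have x a := is_derive_coord p (delta_mx 0 a) ix.
(* [dG a c] follows the formula of [lift_rhsE] node by node and gives its derivative in direction
   [a]. *)
have dG a c := A (N (A (A
  (A (M (a0 a ix) (A (K2 a c iy) (N (A (M (x a) (K2 a c iz))
       (M (K1 a iz) (C ((delta_mx 0 c : E) 0 ix) p (delta_mx 0 a)))))))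
     (M (A (K1 a iy) (N (M (x a) (K1 a iz)))) (a1 a ix c)))
  (A (M (a0 a iy) (N (K2 a c ix))) (M (N (K1 a ix)) (a1 a iy c))))
  (A (M (a0 a iz) (A (N (K1 a c)) (A (M (x a) (K2 a c ix))
       (M (K1 a ix) (C ((delta_mx 0 c : E) 0 ix) p (delta_mx 0 a))))))
     (M (A (N (K0 a)) (M (x a) (K1 a ix))) (a1 a iz c)))))
  (M (M (C 2 p (delta_mx 0 a)) (K1 a iz)) (a0 a c)).
have dalpha_partial a c := etrans
  (esym (near_eq_derive (delta_mx 0 a) (nE c))) (derive_val (is_derive := dG a c)).
have T' a c := is_derive_eq (T a c) (dalpha_partial a c).
have T0' c := is_derive_eq (T0 c) (esym (dalphaE c p Up)).
(* Both [dt] and [dL] follow the formula of [contact_density]. The coordinate x is constant in time,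
   but contributes its own derivative in [dL]. *)
have dt := A (A (A (A (N (T' iy ix)) (T' ix iy))
    (N (M (C (p 0 ix) t 1) (T' ix iz)))) (M (C (p 0 ix) t 1) (T' iz ix)))
    (N (M (C 2 t 1) (T0' iz))).
apply: (is_derive_eq dt).
have dL a := derive_val (is_derive := A (A (A (A (N (a1 a iy ix)) (a1 a ix iy))
    (N (M (x a) (a1 a ix iz)))) (M (x a) (a1 a iz ix)))
    (N (M (C 2 p (delta_mx 0 a)) (a0 a iz)))).
have dLE a : partial a (contact_density (alpha t)) p = _ := dL a.
rewrite /contact_bracket !dLE divergence_contact_field// /contact_density.
have deltaE a : (delta_mx 0 a : E) 0 ix = (ix == a)%:R by rewrite mxE.
rewrite !deltaE /=.
(* Exchanges of the outer pair and of the inner pair together generate all permutations of the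
   indices of a third derivative of [K]. *)
have K2s a b := partial_swap a b sK Up.
have K3o a b c := partial_swap a b (smooth_on_partial c sK) Up.
have K3i b c a := partial_swap_inner a b c sK Up.
have as_ a b c := partial_swap a b (sa c) Up.
(* The symmetries go to the goal first, so that they survive as equations
   between the atoms that replace the partial derivatives. *)
move: (K2s iy ix) (K2s iz ix) (K2s iz iy).
move: (K3o iy ix ix) (K3o iz ix ix) (K3o iz iy ix).
move: (K3o iy ix iy) (K3o iz ix iy) (K3o iz iy iy).
move: (K3o iy ix iz) (K3o iz ix iz) (K3o iz iy iz).
move: (K3i iy ix ix) (K3i iz ix ix) (K3i iz iy ix).
move: (K3i iy ix iy) (K3i iz ix iy) (K3i iz iy iy).
move: (K3i iy ix iz) (K3i iz ix iz) (K3i iz iy iz).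
move: (as_ iy ix ix) (as_ iz ix ix) (as_ iz iy ix).
move: (as_ iy ix iy) (as_ iz ix iy) (as_ iz iy iy).
move: (as_ iy ix iz) (as_ iz ix iz) (as_ iz iy iz).
repeat match goal with |- context [partial ?b ?f p] =>
  generalize (partial b f p); intro end.
move: (K p) (p 0 ix) (alpha t p 0 ix) (alpha t p 0 iy) (alpha t p 0 iz).
by intros; subst; ring.
Qed.

End ContactDivergence.

(** * Equivalence of the two systems and the kinetic equation *)

Theorem mainTheorem6 (R : realType) (U : set 'rV[R]_3) (J : set R)
    (K : 'rV[R]_3 -> R) (alpha : R -> 'rV[R]_3 -> 'rV[R]_3) :
  open U -> open J ->
  smooth_on U K ->
  (forall a : 'I_3,
     smooth_on (J `*` U) (fun q : R * 'rV[R]_3 => alpha q.1 q.2 0 a)) ->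
  let X := contact_field K in
  let divX := divergence U contact_volume X in
  let lift_rhs t p :=
    vertical_rep (cotangent_lift X) (alpha t) p - divX p *: alpha t p in
  let lie_poisson_rhs t (Y : 'I_1 -> 'rV[R]_3 -> 'rV[R]_3) p :=
    - lie_derivative X (one_form (alpha t)) Y p
    - divX p * one_form (alpha t) p (fun i => Y i p) in
  let lift_eqs :=
    forall t p, J t -> U p -> time_deriv alpha t p = lift_rhs t p in
  let lie_poisson_eqs :=
    forall t (Y : 'I_1 -> 'rV[R]_3 -> 'rV[R]_3) p, J t -> U p ->
      (forall i, smooth_vfield_on U (Y i)) ->
      one_form (time_deriv alpha t) p (fun i => Y i p)
      = lie_poisson_rhs t Y p in
  let L t := contact_density (alpha t) in
  [/\ forall t (Y : 'I_1 -> 'rV[R]_3 -> 'rV[R]_3) p, J t -> U p ->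
        (forall i, smooth_vfield_on U (Y i)) ->
        one_form (lift_rhs t) p (fun i => Y i p) = lie_poisson_rhs t Y p,
      lift_eqs <-> lie_poisson_eqs
    & lift_eqs -> forall t p, J t -> U p ->
        is_derive t 1 (fun s => L s p)
          (- contact_bracket (L t) K p - 2 * divX p * L t p)].
Proof.
move=> oU oJ sK salpha X divX lift_rhs lie_poisson_rhs lift_eqs lie_poisson_eqs L.
have rhsE t (Y : 'I_1 -> 'rV[R]_3 -> 'rV[R]_3) p : J t -> U p ->
    (forall i, smooth_vfield_on U (Y i)) ->
    one_form (lift_rhs t) p (fun i => Y i p) = lie_poisson_rhs t Y p.
  move=> Jt Up sY; have sa a : smooth_on U (fun q => alpha t q 0 a).
    exact: (smooth_on_slice (salpha a) Jt).
  rewrite /lie_poisson_rhs lie_derivative_one_form => [|a b|a b].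
  - rewrite opprK /one_form mulr_sumr -sumrB; apply: eq_bigr => a _.
    by rewrite /lift_rhs [in LHS]mxE mulrDl; congr (_ + _);
      rewrite !mxE mulNr mulrA.
  - exact: smooth_on_derivable (sa a) Up.
  - exact: smooth_on_derivable (sY ord0 a) Up.
split=> //; last exact: contact_density_evolution.
split=> [eqs t Y p Jt Up sY|eqs t p Jt Up].
  by rewrite -rhsE// /one_form eqs.
(* For the converse, the Lie-Poisson equations are tested on constant coordinate fields, which
   recover the components of a one-form. *)
have one_formE (w : 'rV[R]_3 -> 'rV[R]_3) a :
    one_form w p (fun=> delta_mx 0 a) = w p 0 a.
  rewrite /one_form (bigD1 a)//= big1 => [|b ba]; rewrite mxE eqxx /=.
    by rewrite eqxx mulr1 addr0.
  by rewrite (negbTE ba) mulr0.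
apply/rowP => a; rewrite -!one_formE.
have sD (i : 'I_1) := smooth_vfield_delta U a.
by rewrite (eqs t (fun _ _ => delta_mx 0 a) p Jt Up sD) -(rhsE _ _ _ Jt Up sD).
Qed.
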